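(* Let $n\ge2$, let $u,w\in\mathbb{N}$ and $v\in\mathbb{Z}$, where $n\mid v$ implies $uw=0$, and let $g=t^{-u}a^vt^w\in BS(1,n)$. If $\mathbf{x}\in\mathcal{L}_v$ is such that $|\eta_{u,v,w}(\mathbf{x})|$ is minimal, i.e. $|\eta_{u,v,w}(\mathbf{x})|\le|\eta_{u,v,w}(\mathbf{y})|$ for all $\mathbf{y}\in\mathcal{L}_v$, then $\eta_{u,v,w}(\mathbf{x})$ is a geodesic (with respect to the generating set $\{a,t\}$) representing $g$.
   Context: $BS(1,n)=\langle t,a\mid tat^{-1}=a^n\rangle$; $\mathbb{N}=\{0,1,2,\dots\}$. For a finitely supported integer sequence $\mathbf{x}=(x_0,x_1,\dots)\in\bigoplus_{i\in\mathbb{N}}\mathbb{Z}$ put $\Sigma(\mathbf{x})=\sum_i x_in^i$, and for $v\in\mathbb{Z}$ let $\mathcal{L}_v=\{\mathbf{x}:\Sigma(\mathbf{x})=v\}$. Let $k_{\mathbf{x}}$ be the index of the last nonzero coordinate of $\mathbf{x}$ (with $k_{\mathbf{0}}=0$). For $u,w\in\mathbb{N}$, $v\in\mathbb{Z}$ and $\mathbf{x}\in\mathcal{L}_v$, writing $k=k_{\mathbf{x}}$, define the word $\eta_{u,v,w}(\mathbf{x})$ in $a^{\pm1},t^{\pm1}$ by - $t^{-u}a^{x_0}ta^{x_1}\cdots ta^{x_k}t^{w-k}$ if $k\le w$ or if $u\le w<k$; - $t^{k-u}a^{x_k}t^{-1}a^{x_{k-1}}\cdots t^{-1}a^{x_0}t^{w}$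 if $w<k\le u$ or if $w<u<k$. $|\cdot|$ denotes the length of the word as written (sum of absolute values of exponents, no cancellation). *)

(* Defs.v *)
From HB Require Import structures.
From mathcomp Require Import all_boot all_order all_algebra.
From mathcomp Require Import boolp.

Set Implicit Arguments.
Unset Strict Implicit.
Unset Printing Implicit Defensive.

Import GRing.Theory.
Local Open Scope ring_scope.
Local Open Scope quotient_scope.

(* A letter (g, e) is the generator g, inverted when e. *)
Definition letter := (bool * bool)%type.
Definition word := seq letter.

Definition genA : bool := false.
Definition genT : bool := true.

(* The word g^m, written as `|m| copies of g or of its inverse. *)
Definition wpow (g : bool) (m : int) : word := nseq `|m|%N (g, m < 0).

(* BS(1, n) is the quotient of the words by the congruence generated by free
   cancellation and by the relation t a t^-1 = a^n. *)
Inductive eqBS (n : nat) : word -> word -> Prop :=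
  | eqBS_refl s : eqBS n s s
  | eqBS_sym s1 s2 : eqBS n s1 s2 -> eqBS n s2 s1
  | eqBS_trans s1 s2 s3 : eqBS n s1 s2 -> eqBS n s2 s3 -> eqBS n s1 s3
  | eqBS_ctx p q s1 s2 : eqBS n s1 s2 -> eqBS n (p ++ s1 ++ q) (p ++ s2 ++ q)
  | eqBS_cancel (g e : bool) : eqBS n [:: (g, e); (g, ~~ e)] [::]
  | eqBS_relator :
      eqBS n (wpow genT 1 ++ wpow genA 1 ++ wpow genT (-1)) (wpow genA n%:Z).

Definition eqBSb (n : nat) : rel word := fun s1 s2 => `[< eqBS n s1 s2 >].

Lemma eqBSb_equiv n : equiv_class_of (eqBSb n).
Proof.
split=> [s|s1 s2|s2 s1 s3]; first exact/asboolP/eqBS_refl.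
  by apply/asboolP/asboolP; exact: eqBS_sym.
by move=> /asboolP h1 /asboolP h2; apply/asboolP; apply: eqBS_trans h1 h2.
Qed.

Canonical eqBS_equiv n := EquivRelPack (eqBSb_equiv n).

Definition BS (n : nat) := {eq_quot eqBS_equiv n}.
HB.instance Definition _ n := Choice.on (BS n).

Definition BS_class (n : nat) (s : word) : BS n :=
  \pi_({eq_quot eqBS_equiv n}) s.
Definition BS_repr (n : nat) (x : BS n) : word := generic_quotient.repr x.

Lemma BS_reprK n : cancel (@BS_repr n) (@BS_class n).
Proof. by move=> x; exact: reprK. Qed.

Lemma BS_classP n s1 s2 : BS_class n s1 = BS_class n s2 <-> eqBS n s1 s2.
Proof.
by split=> [/eqmodP/asboolP|h] //; apply/eqmodP/asboolP.
Qed.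

Definition winv (s : word) : word := rev [seq (l.1, ~~ l.2) | l <- s].

Definition BS_one n : BS n := BS_class n [::].
Definition BS_inv n (x : BS n) : BS n := BS_class n (winv (BS_repr x)).
Definition BS_mul n (x y : BS n) : BS n := BS_class n (BS_repr x ++ BS_repr y).

Lemma eqBS_cat n s1 s2 s3 s4 :
  eqBS n s1 s2 -> eqBS n s3 s4 -> eqBS n (s1 ++ s3) (s2 ++ s4).
Proof.
move=> h1 h2; apply: (@eqBS_trans _ _ (s2 ++ s3)).
  exact: (eqBS_ctx [::] s3 h1).
by have := eqBS_ctx s2 [::] h2; rewrite !cats0.
Qed.

Lemma BS_mul_class n s1 s2 :
  BS_mul (BS_class n s1) (BS_class n s2) = BS_class n (s1 ++ s2).
Proof. by apply/BS_classP/eqBS_cat; apply/BS_classP; exact: BS_reprK. Qed.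

Lemma eqBS_winvr n s : eqBS n (s ++ winv s) [::].
Proof.
elim: s => [|[g e] s IH]; first exact: eqBS_refl.
rewrite /winv /= rev_cons -cats1 -/(winv s).
apply: eqBS_trans (eqBS_cancel n g e).
have := eqBS_ctx [:: (g, e)] [:: (g, ~~ e)] IH.
by rewrite /= -catA.
Qed.

Lemma winvK : involutive winv.
Proof.
move=> s; rewrite /winv map_rev revK -map_comp -[RHS]map_id.
by apply: eq_map => -[g e] /=; rewrite negbK.
Qed.

Lemma BS_mulA n : associative (@BS_mul n).
Proof.
move=> x y z; rewrite -(BS_reprK x) -(BS_reprK y) -(BS_reprK z).
by rewrite !BS_mul_class catA.
Qed.

Lemma BS_mul1 n : left_id (@BS_one n) (@BS_mul n).
Proof. by move=> x; rewrite -(BS_reprK x) BS_mul_class. Qed.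

Lemma BS_mulr1 n : right_id (@BS_one n) (@BS_mul n).
Proof. by move=> x; rewrite -(BS_reprK x) BS_mul_class cats0. Qed.

Lemma BS_mulV n : left_inverse (@BS_one n) (@BS_inv n) (@BS_mul n).
Proof.
move=> x; rewrite -[x in BS_mul _ x]BS_reprK BS_mul_class; apply/BS_classP.
by rewrite -[X in _ ++ X]winvK; exact: eqBS_winvr.
Qed.

Lemma BS_mulrV n : right_inverse (@BS_one n) (@BS_inv n) (@BS_mul n).
Proof.
move=> x; rewrite -[x in BS_mul x]BS_reprK BS_mul_class.
by apply/BS_classP/eqBS_winvr.
Qed.

HB.instance Definition _ n := isGroup.Build (BS n)
  (@BS_mulA n) (@BS_mul1 n) (@BS_mulr1 n) (@BS_mulV n) (@BS_mulrV n).

Definition BS_gen (n : nat) (g : bool) : BS n := BS_class n [:: (g, false)].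
Definition BS_a n : BS n := BS_gen n genA.
Definition BS_t n : BS n := BS_gen n genT.

Definition expgz (G : groupType) (x : G) (m : int) : G :=
  match m with Posz p => (x ^+ p)%g | Negz p => (x ^- p.+1)%g end.

Definition word_val (n : nat) (s : word) : BS n :=
  \big[*%g/1%g]_(l <- s) (if l.2 then (BS_gen n l.1)^-1 else BS_gen n l.1)%g.

Lemma word_valE n s : word_val n s = BS_class n s.
Proof.
rewrite /word_val; elim: s => [|[g e] s IH]; first by rewrite big_nil.
rewrite big_cons IH /= -[(g, e) :: s]cat1s -BS_mul_class; congr (_ * _)%g.
case: e => //; apply/(@mulgI _ (BS_gen n g)); rewrite mulgV.
by rewrite [RHS]BS_mul_class; apply/esym/BS_classP/eqBS_cancel.
Qed.

Lemma word_val_wpow n g m : word_val n (wpow g m) = expgz (BS_gen n g) m.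
Proof.
have iterE (y : BS n) p : iter p (fun z => (y * z)%g) 1%g = (y ^+ p)%g.
  by elim: p => [|p IH]; rewrite ?expg0 //= IH expgS.
case: m => p; rewrite /word_val /wpow big_nseq /= iterE; first exact: erefl.
by rewrite -expgS expVgn.
Qed.

Lemma word_val_cat n s1 s2 :
  word_val n (s1 ++ s2) = (word_val n s1 * word_val n s2)%g.
Proof. by rewrite /word_val big_cat. Qed.

Lemma BS_relation n : (BS_t n * BS_a n * (BS_t n)^-1 = BS_a n ^+ n)%g.
Proof.
have: word_val n (wpow genT 1 ++ wpow genA 1 ++ wpow genT (-1))
      = word_val n (wpow genA n%:Z).
  by rewrite !word_valE; apply/BS_classP/eqBS_relator.
by rewrite !word_val_cat !word_val_wpow mulgA.
Qed.

Definition represents (n : nat) (s : word) (g : BS n) : Prop := word_val n s = g.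

Definition geodesic (n : nat) (s : word) : Prop :=
  forall s' : word, word_val n s' = word_val n s -> (size s <= size s')%N.

(* A finitely supported integer sequence is encoded as a list without trailing
   zero, that is as an element of {poly int}: x`_i is the i-th coordinate, equal
   to 0 for i >= size x. *)
Definition Sigma (n : nat) (x : {poly int}) : int :=
  \sum_(i < size x) x`_i * n%:Z ^+ i.

Definition calL (n : nat) (v : int) (x : {poly int}) : Prop := Sigma n x = v.

Definition klast (x : {poly int}) : nat := (size x).-1.

(* The second branch is exactly w < k <= u or w < u < k. *)
Definition eta_word (u w : nat) (x : {poly int}) : word :=
  let k := klast x in
  if ((k <= w) || (u <= w < k))%N then
    wpow genT (- u%:Z) ++ wpow genA x`_0
      ++ flatten [seq wpow genT 1 ++ wpow genA x`_i | i <- iota 1 k]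
      ++ wpow genT (w%:Z - k%:Z)
  else
    wpow genT (k%:Z - u%:Z) ++ wpow genA x`_k
      ++ flatten [seq wpow genT (-1) ++ wpow genA x`_i | i <- rev (iota 0 k)]
      ++ wpow genT w%:Z.

(* Main.v *)
Require Import Defs.
From mathcomp Require Import all_boot all_order all_algebra.
From mathcomp Require Import zify ring lra.

(** Let [t] act on the rationals as [q |-> n q] and [a] as [q |-> q + 1]. This
    action respects the relation [t a t^-1 = a^n], so the element represented
    by a word [s] determines the exponent sum of [t] in [s] (its height) and the
    number [shift n s] to which [s] sends 0. Reading [s], a letter [a^e] met at
    height [h] contributes [e n^h] to that number. So a word for
    [t^-u a^v t^w], read from starting height [u], ends at height [w], and its
    letters [a] add up to [v] with these weights.

    Collect the letters [a] of such a word by height. Those met at a height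
    [i >= 0] make up the coordinates of a sequence. Those met below height 0
    have weights at most 1, and their total is an integer since [v] and the other
    contributions are integers; adding this integer to coordinate 0 costs at
    most as many letters [a] as it replaces ([coeffs_of_word]). The result is a
    [y] in [L_v] whose coordinates sum in absolute value to at most the number
    of letters [a] in [s].

    It remains to compare the letters [t]. The path of heights of [s] passes
    through 0: otherwise [u] and [w] are positive and every weight is a
    multiple of [n], hence [n] divides [v], which the hypothesis excludes
    ([visits0_or_dvd]). It passes through [k_y] as well, since either [k_y] is
    0 or coordinate [k_y] is nonzero and comes from letters [a] met there. A
    path from [u] to [w] through 0 and [k] visits them in one order or the
    other, and the case distinction in the definition of eta selects the
    cheaper order ([nbT_eta_le]). So [s] is at least as long as [eta(y)], hence
    as [eta(x)] by minimality. *)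

Set Implicit Arguments.
Unset Strict Implicit.
Unset Printing Implicit Defensive.

Import Order.TTheory GRing.Theory Num.Theory.
Local Open Scope ring_scope.

(** * The element represented by eta *)

Lemma expgz_succ (G : groupType) (x : G) (m : int) :
  (expgz x (m + 1)%R = expgz x m * x)%g.
Proof.
case: m => [p|[|p]].
- by rewrite [(_ + 1)%R](_ : _ = Posz p.+1); [exact: expgSr | lia].
- by rewrite /= expg1 mulVg.
- rewrite [_ + 1](_ : _ = Negz p) /=; last by lia.
  by rewrite [in RHS]expgS invgM mulgVK.
Qed.

Lemma expgz_pred (G : groupType) (x : G) (m : int) :
  (expgz x (m - 1)%R = expgz x m * x^-1)%g.
Proof. by rewrite -[in RHS](subrK 1 m) expgz_succ mulgK. Qed.

Lemma expgzD (G : groupType) (x : G) (m1 m2 : int) :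
  (expgz x (m1 + m2)%R = expgz x m1 * expgz x m2)%g.
Proof.
elim/int_rec: m2 => [|p IH|p IH]; first by rewrite addr0 /= mulg1.
  by rewrite -addn1 PoszD addrA !expgz_succ IH mulgA.
rewrite [(- p.+1%:Z)%R](_ : _ = - p%:Z - 1); last by lia.
by rewrite addrA !expgz_pred IH mulgA.
Qed.

Lemma expgzN (G : groupType) (x : G) (m : nat) :
  (expgz x (- m%:Z)%R = x ^- m)%g.
Proof. by case: m => [|m]; rewrite //= invg1. Qed.

(** Conjugation by [t] multiplies exponents of [a] by [n]; this is how the
    letters [t] of eta give coordinate [k] its weight [n^k]. *)
Lemma expgz_BS_t_a n (k : nat) (m : int) :
  (BS_t n ^+ k * expgz (BS_a n) m
   = expgz (BS_a n) (m * n%:Z ^+ k)%R * BS_t n ^+ k)%g.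
Proof.
have ta j :
    (BS_t n * expgz (BS_a n) j = expgz (BS_a n) (j * n%:Z)%R * BS_t n)%g.
  elim/int_rec: j => [|p IH|p IH]; first by rewrite mul0r /= mulg1 mul1g.
    rewrite -addn1 PoszD expgz_succ mulgA IH mulrDl mul1r expgzD.
    by rewrite /= -(BS_relation n) !mulgA mulgVK.
  rewrite [(- p.+1%:Z)%R](_ : _ = - p%:Z - 1); last by lia.
  rewrite expgz_pred mulgA IH mulrBl mul1r expgzD expgzN -(BS_relation n).
  by rewrite !invgM invgK !mulgA mulgVK.
elim: k m => [|k IH] m; first by rewrite mulr1 mulg1 mul1g.
by rewrite expgSr -mulgA ta mulgA IH -mulgA -expgSr exprS mulrA.
Qed.

Lemma SigmaE n (x : {poly int}) : Sigma n x = x.[n%:Z].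
Proof. by rewrite /Sigma horner_coef. Qed.

Lemma horner_klast (x : {poly int}) (c : int) :
  x.[c] = \sum_(i < (klast x).+1) x`_i * c ^+ i.
Proof. by rewrite (@horner_coef_wide _ (klast x).+1) // leqSpred. Qed.

(** The block that eta uses when it climbs from coordinate 0 to coordinate [k]:
    pushing all the letters [t] to the right gathers the coordinates into one
    power of [a]. *)
Lemma word_val_ascent n (f : nat -> int) (k : nat) :
  (word_val n (wpow genA (f 0%N)
     ++ flatten [seq wpow genT 1 ++ wpow genA (f i) | i <- iota 1 k])
   = expgz (BS_a n) (\sum_(i < k.+1) f i * n%:Z ^+ i)%R * BS_t n ^+ k)%g.
Proof.
elim: k => [|k IH].
  by rewrite cats0 word_val_wpow big_ord_recl big_ord0 addr0 /= mulr1 mulg1.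
rewrite -[X in iota 1 X]addn1 iotaD map_cat flatten_cat catA word_val_cat IH.
rewrite [X in word_val n X](_ : _ = wpow genT 1 ++ wpow genA (f k.+1));
  last by rewrite /= cats0.
rewrite [in RHS]big_ord_recr expgzD word_val_cat !word_val_wpow -!mulgA.
congr (_ * _)%g; rewrite [(BS_t n ^+ k * _)%g]mulgA.
rewrite -[expgz (BS_gen n genT) 1]/(BS_t n) -expgSr.
exact: expgz_BS_t_a.
Qed.

(** The block that eta uses when it comes down to coordinate 0. The top
    coordinate is left out because eta writes it before the first [t^-1]. *)
Lemma word_val_descent n (f : nat -> int) (k : nat) :
  (BS_t n ^+ k * word_val n
     (flatten [seq wpow genT (-1) ++ wpow genA (f i) | i <- rev (iota 0 k)])
   = expgz (BS_a n) (\sum_(i < k) f i * n%:Z ^+ i)%R)%g.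
Proof.
elim: k => [|k IH]; first by rewrite /= /word_val big_ord0 big_nil mulg1.
rewrite big_ord_recr [X in expgz _ X]addrC.
rewrite -[X in iota 0 X]addn1 iotaD rev_cat add0n.
rewrite [X in word_val n X](_ : _ = (wpow genT (-1) ++ wpow genA (f k)) ++
  flatten [seq wpow genT (-1) ++ wpow genA (f i) | i <- rev (iota 0 k)]) //.
rewrite !word_val_cat !word_val_wpow expgSr expgzD -IH.
by rewrite /= expg1 !mulgA mulgK expgz_BS_t_a.
Qed.

Lemma eta_represents n (u w : nat) (v : int) (x : {poly int}) : calL n v x ->
  represents (eta_word u w x) (BS_t n ^- u * expgz (BS_a n) v * BS_t n ^+ w)%g.
Proof.
rewrite /calL SigmaE horner_klast /represents /eta_word => <-.
set k := klast x; case: ifP => _.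
  rewrite catA [_ ++ flatten _ ++ _]catA -!catA word_val_cat.
  rewrite [wpow _ _ ++ _]catA.
  rewrite word_val_cat word_val_ascent !word_val_wpow expgzN -!mulgA.
  congr (_ * (_ * _))%g.
  by rewrite -[(BS_t n ^+ k)%g]/(expgz (BS_t n) k%:Z) -expgzD addrC subrK.
rewrite !word_val_cat !word_val_wpow addrC expgzD expgzN /= -!mulgA.
congr (_ * _)%g; rewrite !mulgA expgz_BS_t_a; congr (_ * _)%g.
by rewrite -mulgA word_val_descent -expgzD big_ord_recr addrC.
Qed.

(** * The affine action as an invariant of words *)

Definition letter_sign (l : letter) : int := if l.2 then -1 else 1.

Fixpoint height (s : word) : int :=
  if s is l :: s' then (if l.1 then letter_sign l else 0) + height s' else 0.

(** The image of 0 under the affine map of [s], where [a] acts as [q |-> q + 1]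
    and [t] as [q |-> n q]. *)
Fixpoint shift (n : nat) (s : word) : rat :=
  if s is l :: s' then
    if l.1 then n%:R ^ letter_sign l * shift n s'
    else (letter_sign l)%:~R + shift n s'
  else 0.

Definition nbA (s : word) : nat := count (fun l => ~~ l.1) s.
Definition nbT (s : word) : nat := count (fun l => l.1) s.

Lemma nbA_nbT s : size s = (nbA s + nbT s)%N.
Proof. by rewrite addnC -(count_predC (fun l : letter => l.1)). Qed.

Lemma height_cat s1 s2 : height (s1 ++ s2) = height s1 + height s2.
Proof. by elim: s1 => [|l s1 IH] /=; rewrite ?add0r // IH addrA. Qed.

(** The composition rule of affine maps: the linear part of [s1] is
    multiplication by [n ^ height s1]. *)
Lemma shift_cat n s1 s2 : (0 < n)%N ->
  shift n (s1 ++ s2) = shift n s1 + n%:R ^ height s1 * shift n s2.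
Proof.
move=> n_gt0; have n0 : n%:R != 0 :> rat by rewrite pnatr_eq0 -lt0n.
elim: s1 => [|[[] e] s1 IH] /=; rewrite ?expr0z ?add0r ?mul1r // IH.
  by rewrite expfzDr // mulrDr mulrA.
by rewrite addrA.
Qed.

Lemma height_wpow g m : height (wpow g m) = if g then m else 0.
Proof.
have E k e : height (nseq k (g, e)) = if g then letter_sign (g, e) * k%:Z else 0.
  elim: k => [|k IH] /=; first by case: g; rewrite ?mulr0.
  by rewrite IH; case: g {IH} => //; rewrite -addn1 PoszD mulrDr mulr1 addrC.
rewrite /wpow E; case: g {E} => //; rewrite /letter_sign /=.
by case: ltP; lia.
Qed.

Lemma shift_wpowA n m : shift n (wpow genA m) = m%:~R.
Proof.
have E k e : shift n (nseq k (genA, e)) = (letter_sign (genA, e) * k%:Z)%:~R.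
  elim: k => [|k IH] /=; first by rewrite mulr0.
  by rewrite IH -intrD -addn1 PoszD mulrDr mulr1 addrC.
by rewrite /wpow E /letter_sign /=; congr _%:~R; case: ltP; lia.
Qed.

Lemma shift_wpowT n m : shift n (wpow genT m) = 0.
Proof. by rewrite /wpow; elim: `|m|%N => //= k ->; rewrite mulr0. Qed.

(** The affine action factors through the group: the two generating relations
    hold for the maps, and [shift_cat] makes the invariants compatible with
    contexts. *)
Lemma eqBS_height_shift n s1 s2 : (0 < n)%N -> eqBS n s1 s2 ->
  height s1 = height s2 /\ shift n s1 = shift n s2.
Proof.
move=> n_gt0; have n0 : n%:R != 0 :> rat by rewrite pnatr_eq0 -lt0n.
elim=> {s1 s2} [//|s1 s2 _ [-> ->]//|s1 s2 s3 _ [-> ->] _ [-> ->]//| | |].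
- by move=> p q s1 s2 _ [h1 h2]; rewrite !height_cat !shift_cat // h1 h2.
- by move=> [] [] /=; split; rewrite ?mulr0 ?addr0 ?addrN ?addNr // -intrD.
- rewrite !height_cat !shift_cat // !height_wpow !shift_wpowA !shift_wpowT.
  by split=> //=; rewrite expr0z expr1z mulr0 addr0 add0r mulr1.
Qed.

(** * Paths of heights and their number of letters t *)

Definition visits (p : int) (s : word) (h : int) : Prop :=
  exists s1 s2, s = s1 ++ s2 /\ p + height s1 = h.

Lemma visits_start p s : visits p s p.
Proof. by exists [::], s; rewrite /= addr0. Qed.

Lemma visits_end p s : visits p s (p + height s).
Proof. by exists s, [::]; rewrite cats0. Qed.

Lemma visits_cons p l s h :
  visits (p + height [:: l]) s h -> visits p (l :: s) h.
Proof.
move=> [s1 [s2 [-> <-]]]; exists (l :: s1), s2; split=> //.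
by rewrite /= addr0 addrA.
Qed.

(** Of two prefixes of a word one is a prefix of the other, so the two heights
    are reached in one order or the other. *)
Lemma visits2 p s h1 h2 : visits p s h1 -> visits p s h2 ->
  exists s1 s2 s3, s = s1 ++ s2 ++ s3 /\
    (p + height s1 = h1 /\ p + height s1 + height s2 = h2 \/
     p + height s1 = h2 /\ p + height s1 + height s2 = h1).
Proof.
have W a1 a2 b1 b2 : a1 ++ a2 = b1 ++ b2 :> word -> (size a1 <= size b1)%N ->
    exists c, b1 = a1 ++ c /\ a2 = c ++ b2.
  elim: a1 b1 => [|l a1 IH] [|m b1] //=.
  - by exists [::].
  - by exists (m :: b1).
  - by move=> [-> /IH h] /h [c [-> ->]]; exists c.
move=> [a1 [a2 [-> <-]]] [b1 [b2 [e <-]]].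
case: (leqP (size a1) (size b1)) => [le|/ltnW le].
  have [c [-> ->]] := W _ _ _ _ e le.
  by exists a1, c, b2; split=> //; left; rewrite height_cat addrA.
have [c [-> eb]] := W _ _ _ _ (esym e) le.
by exists b1, c, a2; rewrite -catA; split=> //; right; rewrite height_cat addrA.
Qed.

Lemma height_le_nbT s : `|height s| <= (nbT s)%:Z.
Proof.
elim: s => [|[g e] s IH] //=; rewrite /nbT /= -/(nbT s) PoszD.
apply: le_trans (ler_normD _ _) _; apply: lerD => //.
by case: g; case: e.
Qed.

Lemma nbT_cat s1 s2 : nbT (s1 ++ s2) = (nbT s1 + nbT s2)%N.
Proof. exact: count_cat. Qed.

(** The first case is the length of the path [u -> 0 -> k -> w], the second that
    of the path [u -> k -> 0 -> w]. *)
Definition nbT_eta (u w k : nat) : nat :=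
  if ((k <= w) || (u <= w < k))%N then (u + k + `|w%:Z - k%:Z|)%N
  else (`|k%:Z - u%:Z| + k + w)%N.

(** A piece of [s] between two heights has at least as many letters [t] as their
    distance, so [s] has as many as one of the two routes through 0 and [k].
    The route of eta is a shortest one. Beginning with 0 has length [u + w] when
    [k <= w], beginning with [k] has length [u + w] when [k <= u], and no route
    through 0 is shorter. When [k] exceeds both, the lengths are [u + 2k - w] and
    [2k - u + w], so beginning with 0 is no longer exactly when [u <= w]. *)
Lemma nbT_eta_le (u w k : nat) (s : word) : u%:Z + height s = w%:Z ->
  visits u s 0 -> visits u s k -> (nbT_eta u w k <= nbT s)%N.
Proof.
move=> hs v0 vk; have [s1 [s2 [s3 [es H]]]] := visits2 v0 vk.
move: hs; rewrite /nbT_eta es !height_cat !nbT_cat.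
move: (height_le_nbT s1) (height_le_nbT s2) (height_le_nbT s3).
move: (height s1) (height s2) (height s3) (nbT s1) (nbT s2) (nbT s3) H.
move=> h1 h2 h3 n1 n2 n3; case: ifP; lia.
Qed.

(** * The length of eta *)

Definition norm1 (y : {poly int}) : nat := (\sum_(i < size y) absz (y`_i)%R)%N.

(** Used to compare polynomials of different degrees over a common range. *)
Lemma norm1_wide (y : {poly int}) (N : nat) : (size y <= N)%N ->
  norm1 y = (\sum_(i < N) absz (y`_i)%R)%N.
Proof.
rewrite /norm1 => le.
rewrite (big_ord_widen N (fun i => absz (y`_i)%R) le) big_mkcond.
apply: eq_bigr => i _; case: ltnP => // lei.
by rewrite nth_default.
Qed.

Lemma norm1D (y z : {poly int}) : (norm1 (y + z) <= norm1 y + norm1 z)%N.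
Proof.
pose N := maxn (size y) (size z).
rewrite (@norm1_wide _ N) ?size_polyD // (@norm1_wide y N) ?leq_maxl //.
rewrite (@norm1_wide z N) ?leq_maxr // -big_split; apply: leq_sum => i _ /=.
by rewrite coefD; move: (y`_i)%R (z`_i)%R => a b; lia.
Qed.

Lemma norm1_monomial (c : int) (i : nat) : (norm1 (c *: 'X^i) <= `|c|)%N.
Proof.
rewrite (@norm1_wide _ i.+1); last first.
  by apply: leq_trans (size_scale_leq _ _) _; rewrite size_polyXn.
rewrite big_ord_recr /= big1 ?add0n => [|j _].
  by rewrite coefZ coefXn eqxx mulr1.
by rewrite coefZ coefXn ltn_eqF // mulr0.
Qed.

Lemma size_eta (u w : nat) (x : {poly int}) :
  size (eta_word u w x) = (nbT_eta u w (klast x) + norm1 x)%N.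
Proof.
have szw g m : size (wpow g m) = `|m|%N by rewrite size_nseq.
have szf (m : int) (r : seq nat) : `|m|%N = 1%N ->
    size (flatten [seq wpow genT m ++ wpow genA x`_i | i <- r])
    = (size r + \sum_(i <- r) absz (x`_i)%R)%N.
  move=> m1; elim: r => [|i r IH]; first by rewrite big_nil.
  by rewrite big_cons /= !size_cat !szw IH m1 addnACA add1n.
rewrite (@norm1_wide _ (klast x).+1) ?leqSpred //.
rewrite /eta_word /nbT_eta; set k := klast x; case: ifP => _.
  rewrite !size_cat !szw szf // size_iota big_ord_recl.
  rewrite (_ : (\sum_(i <- iota 1 k) absz (x`_i)%R)%N
             = (\sum_(i < k) absz (x`_(bump 0 i))%R)%N); last first.
    rewrite -[1%N]addn0 iotaDl big_map.
    rewrite -(big_mkord xpredT (fun i => absz (x`_(1 + i))%R)).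
    by rewrite /index_iota subn0.
  by rewrite abszN /=; move: (bigop.body _ _ _) (absz x`_0%R) => S c; lia.
rewrite !size_cat !szw szf // size_rev size_iota big_ord_recr /=.
rewrite (perm_big (iota 0 k)) ?perm_rev //= (_ : iota 0 k = index_iota 0 k).
  by rewrite big_mkord; move: (bigop.body _ _ _) (absz x`_k%R) => S c; lia.
by rewrite /index_iota subn0.
Qed.

(** * Reading a sequence off a word *)

(** Heights change by at most 1 at each letter, so a path that starts above 0
    and avoids 0 stays above it, and then every letter [a] is weighted by a
    positive power of [n]. *)
Lemma visits0_or_dvd n (p : nat) (s : word) : (0 < n)%N ->
  visits p.+1 s 0 \/
  exists z : int, n%:R ^+ p.+1 * shift n s = (n%:Z * z)%:~R.
Proof.
move=> n_gt0; have n0 : n%:R != 0 :> rat by rewrite pnatr_eq0 -lt0n.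
elim: s p => [|[[] e] s IH] p; first by right; exists 0; rewrite !mulr0.
- have step (q : nat) : p.+1%:Z + height [:: (true, e)] = q.+1 ->
      visits p.+1 ((true, e) :: s) 0 \/
      exists z : int, n%:R ^+ p.+1 * shift n ((true, e) :: s) = (n%:Z * z)%:~R.
    move=> eq_q; case: (IH q) => [v|[z ez]].
      by left; apply: visits_cons; rewrite eq_q.
    right; exists z; rewrite -ez /= mulrA !exprnP -expfzDr //.
    by rewrite -eq_q /= addr0.
  case: e step => step; last first.
    by apply: (step p.+1); rewrite /= addr0 /letter_sign /=; lia.
  case: p step {IH} => [|p] step; last first.
    by apply: (step p); rewrite /= addr0 /letter_sign /=; lia.
  by left; apply: visits_cons; exact: visits_start.
- case: (IH p) => [v|[z ez]].
    by left; apply: visits_cons; rewrite /= !addr0.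
  right; exists (n%:Z ^+ p * letter_sign (false, e) + z).
  rewrite /= mulrDr ez; have -> : n%:R ^+ p.+1 = (n%:Z ^+ p.+1)%:~R :> rat.
    by rewrite rmorphXn.
  by rewrite -intrM -intrD exprS; congr _%:~R; ring.
Qed.

(** Here [y] collects the letters [a] met at heights at least 0 and [r] is the
    total weight of those met below 0. The weight of each of the latter is at
    most 1 in absolute value, which is why [r] is charged like a coordinate. *)
Lemma coeffs_of_word n (p : int) (s : word) : (0 < n)%N ->
  exists (y : {poly int}) (r : rat),
  [/\ n%:R ^ p * shift n s = (y.[n%:Z])%:~R + r,
      (norm1 y)%:R + `|r| <= (nbA s)%:R
    & forall i : nat, y`_i != 0 -> visits p s i].
Proof.
move=> n_gt0; have n0 : n%:R != 0 :> rat by rewrite pnatr_eq0 -lt0n.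
elim: s p => [|l s IH] p.
  exists 0, 0; split=> [||i]; rewrite ?coef0 ?eqxx //.
    by rewrite horner0 addr0 mulr0.
  by rewrite /norm1 size_poly0 big_ord0 normr0 addr0.
have [y [r [yr yr_le yv]]] := IH (p + height [:: l]).
have yv' i : y`_i != 0 -> visits p (l :: s) i by move=> /yv; exact: visits_cons.
case: l yr yv yv' => [[] e] yr yv yv'.
  exists y, r; split=> //.
  by rewrite -yr /= addr0 expfzDr // mulrA.
rewrite /= !addr0 in yr; pose c := letter_sign (false, e).
have c1 : `|c| = 1 by rewrite /c /letter_sign; case: (e).
have -> : nbA ((false, e) :: s) = (nbA s).+1 by [].
case: p yr {yv} yv' => [p|p] yr yv.
  exists (c *: 'X^p + y), r; split.
  - rewrite /= mulrDr yr hornerD hornerZ hornerXn rmorphD rmorphM /= rmorphXn.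
    by rewrite addrA mulrC.
  - have := norm1D (c *: 'X^p) y; have := norm1_monomial c p.
    have -> : `|c|%N = 1%N by apply/eqP; rewrite -eqz_nat abszE c1.
    move=> h1 h2; have : (norm1 (c *: 'X^p + y) <= (norm1 y).+1)%N.
      by apply: leq_trans h2 _; rewrite -add1n leq_add2r.
    rewrite -(ler_nat rat) => h3; move: yr_le h3.
    by rewrite -[(norm1 y).+1]addn1 -[(nbA s).+1]addn1 !natrD; lra.
  - move=> i; rewrite coefD coefZ coefXn; case: (eqVneq i p) => [-> _|_].
      exact: visits_start.
    by rewrite mulr0 add0r; exact: yv.
exists y, (n%:R ^ (Negz p) * c%:~R + r); split=> //.
  by rewrite /= mulrDr yr addrCA.
have : `|n%:R ^ Negz p * c%:~R + r| <= 1 + `|r|.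
  apply: le_trans (ler_normD _ _) _; rewrite lerD2r normrM -intr_norm c1 mulr1.
  rewrite NegzE -exprnN normfV normrX normr_nat invf_le1 ?exprn_gt0 ?ltr0n //.
  by rewrite exprn_ege1 // ler1n.
by move: yr_le; rewrite -[(nbA s).+1]addn1 natrD; lra.
Qed.

(** * Minimal eta words are geodesic *)

Theorem lemma3p9 (n : nat) (hn : (2 <= n)%N) (u w : nat) (v : int)
    (huw : (n%:Z %| v)%Z -> (u * w)%N = 0%N)
    (x : {poly int}) (hx : calL n v x)
    (hmin : forall y : {poly int}, calL n v y ->
              (size (eta_word u w x) <= size (eta_word u w y))%N) :
  represents (eta_word u w x) (BS_t n ^- u * expgz (BS_a n) v * BS_t n ^+ w)%g
  /\ geodesic n (eta_word u w x).
Proof.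
have n_gt0 : (0 < n)%N by lia.
have n0 : n%:R != 0 :> rat by rewrite pnatr_eq0 -lt0n.
have rep := eta_represents u w hx; split=> // s; rewrite {}rep => es.
have {es} [hs ss] : u%:Z + height s = w%:Z /\ n%:R ^ u%:Z * shift n s = v%:~R.
  have : eqBS n s (wpow genT (- u%:Z) ++ wpow genA v ++ wpow genT w%:Z).
    apply/BS_classP; rewrite -!word_valE es !word_val_cat !word_val_wpow.
    by rewrite expgzN mulgA.
  move=> /(eqBS_height_shift n_gt0); rewrite !height_cat !shift_cat //.
  rewrite !height_wpow shift_wpowA !shift_wpowT /= add0r => -[-> ->].
  split; first by lia.
  by rewrite mulr0 addr0 add0r mulrA -expfzDr // subrr expr0z mul1r.
have visit0 : visits u s 0.
  case: (posnP u) hs ss huw => [-> _ _ _|u_gt0]; first exact: visits_start.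
  case: (posnP w) => [-> hs _ _|w_gt0 _ ss huw].
    by have := visits_end u s; rewrite hs.
  case: (visits0_or_dvd u.-1 s n_gt0); rewrite prednK // => -[z].
  rewrite exprnP ss => /intr_inj vz.
  by have := huw _; rewrite vz dvdz_mulr // => /(_ isT); lia.
have [y [r [yr yr_le yv]]] := coeffs_of_word u s n_gt0.
(* The contributions from below height 0 form an integer, because v and all the
   others are integers; it becomes part of coordinate 0. *)
pose c := v - y.[n%:Z].
have rc : r = c%:~R by rewrite /c rmorphB /= -ss yr; ring.
have hy : calL n v (c *: 'X^0 + y).
  by rewrite /calL SigmaE hornerD hornerZ hornerXn expr0 mulr1 subrK.
apply: leq_trans (hmin _ hy) _; rewrite size_eta nbA_nbT addnC.
apply: leq_add.
  apply: leq_trans (norm1D _ _) _; have := norm1_monomial c 0.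
  suff : (norm1 y + `|c| <= nbA s)%N by lia.
  by rewrite -(ler_nat rat) natrD natr_absz intr_norm -rc.
apply: nbT_eta_le => //.
(* The correction by c does not affect coordinates of positive index, so these
   are nonzero only at visited heights. *)
case: (posnP (klast (c *: 'X^0 + y))) => [->//|k_gt0].
apply: yv; have : lead_coef (c *: 'X^0 + y) != 0.
  rewrite lead_coef_eq0; apply: contraTneq k_gt0 => ->.
  by rewrite /klast size_poly0.
rewrite /lead_coef -/(klast _) {1}coefD coefZ coefXn.
by rewrite (gtn_eqF k_gt0) mulr0 add0r.
Qed.
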